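(* Suppose Assumption 1 (stated in the context) holds. Given $x^0\in\operatorname{dom}\varphi$, let $(x^k)_{k\in\mathbb{N}}$ be the random sequence generated by the ARBPG algorithm (described in the context). Assume that $(x^{k+1},d^k,\lambda_k)$ is $\mathcal{F}_k$-measurable for all $k\ge 0$, where $\mathcal{F}_k:=\sigma(\{i_0,\ldots,i_k\})$. Then, almost surely, the following statements hold: (i) Any accumulation point $x^*$ of the sequence $(x^k)_{k\in\mathbb{N}}$ is a stationary point of the problem $\min_{x\in\mathbb{R}^n}\varphi(x)$, i.e. $0\in\partial\varphi(x^* )$ (equivalently $0\in\nabla f(x^* )+\partial g(x^* )$). (ii) If $(x^k)_{k\in\mathbb{N}}$ has at least one isolated accumulation point, then the whole sequence $(x^k)_{k\in\mathbb{N}}$ converges to a stationary point of $\min_{x\in\mathbb{R}^n}\varphi(x)$.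
   Context: Notation. $\overline{\mathbb{R}}=\mathbb{R}\cup\{\pm\infty\}$; $\|\cdot\|$ is the Euclidean norm; $\mathbb{N}=\{0,1,2,\ldots\}$. Vectors $x\in\mathbb{R}^n$ are split into $N\ge1$ blocks $x_i\in\mathbb{R}^{n_i}$, $\sum_{i=1}^N n_i=n$. Write the identity as $I_n=[U_1,\ldots,U_N]$ with $U_i\in\mathbb{R}^{n\times n_i}$, so $x_i=U_i^Tx$, and $\nabla_i f(x):=U_i^T\nabla f(x)$. For $h:\mathbb{R}^m\to\overline{\mathbb{R}}$, $\operatorname{dom}h=\{x: h(x)<+\infty\}$; $h$ is proper if it never takes the value $-\infty$ and $\operatorname{dom}h\ne\emptyset$; lsc means lower semicontinuous. $\operatorname{prox}_h(x):=\operatorname{argmin}_{u}\{h(u)+\frac12\|x-u\|^2\}$ (set-valued). $h$ is prox-bounded if $h+\frac{1}{2\tau}\|\cdot\|^2$ is bounded from below on $\mathbb{R}^m$ for some $\tau>0$; the supremum of such $\tau$ is the prox-boundedness threshold $\tau^h\in(0,+\infty]$. A smooth function is a differentiable function with continuous gradient. The regular subdifferential at $\bar x$ with $h(\bar x)\in\mathbb{R}$ is $\partial h(\bar x)=\{v: h(x)\ge h(\bar x)+\langle v,x-\bar x\rangle+o(\|x-\bar x\|)\}$, and $\partial h(\bar x)=\emptyset$ if $|h(\bar x)|=+\infty$. A stationary point of $\min\varphi$ is a point $x^*$ with $\varphi(x^* )\in\mathbb{R}$ and $0\in\partial\varphi(x^* )$. Assumption 1. $\varphi=f+g$ where: (i)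 $f:\mathbb{R}^n\to\mathbb{R}$ is smooth and for every $\bar x\in\operatorname{dom}g$ there exist convex neighborhoods $V_i$ of $\bar x$ and constants $L_i(\bar x)>0$ such that for all $i\in\{1,\ldots,N\}$, $\|\nabla_i f(x+U_is_i)-\nabla_i f(x)\|\le L_i(\bar x)\|s_i\|$ for all $x,\,x+U_is_i\in V_i$; (ii) $g:\mathbb{R}^n\to\overline{\mathbb{R}}$ has the form $g(x)=\sum_{i=1}^N g_i(x_i)$ with each $g_i:\mathbb{R}^{n_i}\to\overline{\mathbb{R}}$ proper, lsc and prox-bounded; (iii) $\inf_{x\in\mathbb{R}^n}\varphi(x)>-\infty$. ARBPG algorithm. Input: $x^0\in\operatorname{dom}\varphi$; $0<\underline\tau\le\bar\tau$; $a,\alpha>0$; $\beta\in(0,1)$; probabilities $p_1,\ldots,p_N>0$ with $\sum_i p_i=1$. For $k=0,1,2,\ldots$: 1. Draw a random block index $i_k\in\{1,\ldots,N\}$ with $\mathbb{P}(i_k=i)=p_i$, independently of $i_0,\ldots,i_{k-1}$ (so $\mathbb{P}(i_k=i\mid\mathcal{F}_{k-1})=p_i$, with $\mathcal F_{-1}$ trivial). 2. Choose $\bar\tau_k\in[\underline\tau,\min\{\bar\tau,\tau^{g_{i_k}}\})$; set $t=0$. 3. Set $\tau_k:=\beta^t\bar\tau_k$ and compute $d^k\in\mathbb{R}^n$ with $d^k_i=0$ for $i\ne i_k$ and $d^k_{i_k}\in\operatorname{prox}_{\tau_kg_{i_k}}\big(x^k_{i_k}-\tau_k\nabla_{i_k}f(x^k)\big)-x^k_{i_k}$.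 4. If $d^k_{i_k}=0$, set $x^{k+1}:=x^k$ (and, by convention, $\lambda_k:=0$) and pass to iteration $k+1$. 5. If $\varphi(x^k+d^k)\le\varphi(x^k)-a\|d^k\|^2$, set $\hat x^k:=x^k+d^k$ and go to step 6; otherwise increase $t$ by $1$ and return to step 3. 6. Pick any $\lambda_k\ge0$ such that $\varphi(\hat x^k+\lambda_kd^k)\le\varphi(\hat x^k)-\alpha\lambda_k^2\|d^k\|^2$ ($\lambda_k=0$ is allowed). 7. Set $x^{k+1}:=\hat x^k+\lambda_kd^k$ and pass to iteration $k+1$. All random variables live on a probability space $(\Omega,\mathcal{A},\mathbb{P})$. *)

(* Defs.v *)
From HB Require Import structures.
From mathcomp Require Import all_boot all_order all_algebra.
From mathcomp Require Import all_classical all_reals all_analysis.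

Set Implicit Arguments.
Unset Strict Implicit.
Unset Printing Implicit Defensive.
Import Order.TTheory GRing.Theory Num.Theory.
Import numFieldNormedType.Exports.
Local Open Scope classical_set_scope.
Local Open Scope ring_scope.

(* The library norm [`| x |] on matrices is the sup norm; [enorm] is the
   Euclidean one. Both induce the same topology. *)
Definition dotv (R : realType) (n : nat) (u v : 'cV[R]_n) : R :=
  \sum_(j < n) u j 0 * v j 0.

Definition enorm (R : realType) (n : nat) (x : 'cV[R]_n) : R :=
  Num.sqrt (dotv x x).

Definition grad (R : realType) (n : nat) (f : 'cV[R]_n -> R) (x : 'cV[R]_n) :
  'cV[R]_n := \col_j 'D_(delta_mx j 0) (f : 'cV[R]_n -> R^o) x.

Definition smooth (R : realType) (n : nat) (f : 'cV[R]_n -> R) : Prop :=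
  (forall x, differentiable (f : 'cV[R]_n -> R^o) x) /\ continuous (grad f).

(* The blocks of the identity, I = [U_1, ..., U_N]. *)
Definition Umx (R : realType) (N : nat) (n_ : 'I_N -> nat) (i : 'I_N) :
  'M[R]_(\sum_(j < N) n_ j, n_ i) := submxrow 1%:M i.

Definition blk (R : realType) (N : nat) (n_ : 'I_N -> nat) (i : 'I_N)
  (x : 'cV[R]_(\sum_(j < N) n_ j)) : 'cV[R]_(n_ i) := (Umx R n_ i)^T *m x.

Section ExtendedRealFunctions.
Context (R : realType) (m : nat).
Implicit Types (h : 'cV[R]_m -> \bar R) (x u v w : 'cV[R]_m).
Local Open Scope ereal_scope.

Definition dom h : set 'cV[R]_m := [set x | h x < +oo].

Definition proper h : Prop := (forall x, h x != -oo) /\ dom h !=set0.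

Definition prox h x : set 'cV[R]_m :=
  [set u | forall w, h u + (2^-1 * enorm (x - u) ^+ 2)%:E
                     <= h w + (2^-1 * enorm (x - w) ^+ 2)%:E].

Definition prox_bounded_with h (tau : R) : Prop :=
  exists M : R, forall x, M%:E <= h x + ((2 * tau)^-1 * enorm x ^+ 2)%:E.

Definition prox_bounded h : Prop :=
  exists2 tau : R, (0 < tau)%R & prox_bounded_with h tau.

Definition prox_threshold h : \bar R :=
  ereal_sup [set tau%:E | tau in [set tau : R |
    (0 < tau)%R /\ prox_bounded_with h tau]].

Definition subdiff h x : set 'cV[R]_m :=
  [set v | h x \is a fin_num /\
    exists r : 'cV[R]_m -> R^o,
      r =o_x (fun y => enorm (y - x) : R^o) /\
      \forall y \near x, h x + (dotv v (y - x) + r y)%:E <= h y].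

Definition stationary h x : Prop := h x \is a fin_num /\ subdiff h x 0%R.

End ExtendedRealFunctions.

Section Problem.
Context (R : realType) (N : nat) (n_ : 'I_N -> nat).
Local Notation V := 'cV[R]_(\sum_(j < N) n_ j).
Implicit Types (f : V -> R) (g : forall i : 'I_N, 'cV[R]_(n_ i) -> \bar R).
Local Open Scope ereal_scope.

Definition gsum g (x : V) : \bar R := \sum_(i < N) g i (blk i x).

Definition phi f g (x : V) : \bar R := (f x)%:E + gsum g x.

Definition block_locally_lipschitz f (D : set V) : Prop :=
  forall xbar, D xbar ->
  exists (W : 'I_N -> set V) (L : 'I_N -> R), forall i : 'I_N,
    [/\ nbhs xbar (W i), convex_set (W i : set (convex_lmodType V)),
        (0 < L i)%R &
        forall (x : V) (s : 'cV[R]_(n_ i)),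
          W i x -> W i (x + Umx R n_ i *m s)%R ->
          (enorm (blk i (grad f (x + Umx R n_ i *m s)) - blk i (grad f x))
            <= L i * enorm s)%R].

Definition assumption1 f g : Prop :=
  [/\ smooth f,
      block_locally_lipschitz f (dom (gsum g)),
      forall i, [/\ proper (g i), lower_semicontinuous (g i)
                  & prox_bounded (g i)]
    & -oo < ereal_inf (range (phi f g))].

End Problem.

Section Algorithm.
Context (R : realType) (N : nat) (n_ : 'I_N -> nat).
Local Notation V := 'cV[R]_(\sum_(j < N) n_ j).
Implicit Types (f : V -> R) (g : forall i : 'I_N, 'cV[R]_(n_ i) -> \bar R).
Local Open Scope ereal_scope.

Definition prox_direction f g (i : 'I_N) (tau : R) (x d : V) : Prop :=
  (forall j, j != i -> blk j d = 0%R) /\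
  prox (fun u => tau%:E * g i u)
    (blk i x - tau *: blk i (grad f x))%R (blk i x + blk i d)%R.

Definition sufficient_decrease f g (a : R) (x d : V) : Prop :=
  phi f g (x + d)%R <= phi f g x - (a * enorm d ^+ 2)%:E.

(* One iteration with block [i], from [x] to [xnext]. [T] is the value of the
   backtracking counter [t] when the inner loop is left, and [dt t] is the
   direction computed on its [t]-th pass, so that [d = dt T]. *)
Definition arbpg_iteration f g (taulo tauhi a alpha beta : R)
    (i : 'I_N) (x d : V) (lambda : R) (xnext : V) : Prop :=
  exists (taubar : R) (T : nat) (dt : nat -> V),
  [/\ (taulo <= taubar)%R /\
        taubar%:E < Order.min tauhi%:E (prox_threshold (g i)),
      forall t, (t <= T)%N ->
        prox_direction f g i (beta ^+ t * taubar)%R x (dt t),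
      forall t, (t < T)%N ->
        blk i (dt t) <> 0%R /\ ~ sufficient_decrease f g a x (dt t),
      d = dt T
    & (blk i d = 0%R /\ xnext = x /\ lambda = 0%R) \/
      [/\ blk i d <> 0%R, sufficient_decrease f g a x d, (0 <= lambda)%R,
          phi f g (x + d + lambda *: d)%R
            <= phi f g (x + d)%R - (alpha * lambda ^+ 2 * enorm d ^+ 2)%:E
        & xnext = (x + d + lambda *: d)%R]].

End Algorithm.

(* [past ix k] generates sigma(i_0, ..., i_{k-1}), so F_k = <<s past ix k.+1 >>
   and <<s past ix 0 >> is the trivial sigma-algebra F_{-1}. *)
Definition past (Omega : Type) (N : nat) (ix : nat -> Omega -> 'I_N) (k : nat) :
  set (set Omega) :=
  [set A | exists j (B : set 'I_N), (j < k)%N /\ A = ix j @^-1` B].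

Definition block_sampling (disp : measure_display) (Omega : measurableType disp)
    (R : realType) (P : probability Omega R) (N : nat) (p : 'I_N -> R)
    (ix : nat -> Omega -> 'I_N) : Prop :=
  forall k i, let E := ix k @^-1` [set i] in
    [/\ measurable E, P E = (p i)%:E
      & forall A, <<s past ix k >> A -> P (A `&` E) = (P A * P E)%E].

(* Measurability from the sigma-algebra generated by [G] to the Borel
   sigma-algebra of [T]. *)
Definition borel_measurable (Omega : Type) (G : set (set Omega))
    (T : topologicalType) (X : Omega -> T) : Prop :=
  forall B : set T, <<s (@open T) >> B -> <<s G >> (X @^-1` B).

(* Main.v *)
Require Import Defs.
From HB Require Import structures.
From mathcomp Require Import all_boot all_order all_algebra.
From mathcomp Require Import all_classical all_reals all_analysis.
From mathcomp Require Import measurable_realfun ring lra.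

Set Implicit Arguments.
Unset Strict Implicit.
Unset Printing Implicit Defensive.
Import Order.TTheory GRing.Theory Num.Theory.
Import numFieldNormedType.Exports.
Local Open Scope classical_set_scope.
Local Open Scope ring_scope.

(* Along the run the objective decreases by at least
   [(a + alpha lambda_k^2) |d^k|^2] at step [k], so [d^k -> 0] and
   [x^{k+1} - x^k -> 0] surely. By adaptedness, the direction that block [i]
   would produce at time [k] is a function of the past [i_0, ..., i_{k-1}];
   since it is realised with conditional probability [p i], a conditional
   Borel-Cantelli argument makes these virtual directions vanish almost surely
   for all blocks at once. Near a cluster point the backtracking accepts every
   stepsize below some threshold, so the stepsizes stay bounded away from [0] and
   the prox inequalities of all the blocks pass to the limit; summed over the
   blocks they give stationarity. An isolated cluster point attracts the whole
   sequence because the steps become too short to leave its neighborhood. *)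

(** * Euclidean inner product and norm, and the topology they induce *)

Section Euclidean.
Context (R : realType) (n : nat).
Implicit Types (u v x y : 'cV[R]_n) (c : R).

Lemma dotvC u v : dotv u v = dotv v u.
Proof. by apply: eq_bigr => j _; rewrite mulrC. Qed.

Lemma dotvDl u v x : dotv (u + v) x = dotv u x + dotv v x.
Proof. by rewrite -big_split; apply: eq_bigr => j _; rewrite mxE mulrDl. Qed.

Lemma dotvZl c u v : dotv (c *: u) v = c * dotv u v.
Proof. by rewrite mulr_sumr; apply: eq_bigr => j _; rewrite mxE mulrA. Qed.

Lemma dotvDr x u v : dotv x (u + v) = dotv x u + dotv x v.
Proof. by rewrite dotvC dotvDl !(dotvC x). Qed.

Lemma dotvZr c u v : dotv u (c *: v) = c * dotv u v.
Proof. by rewrite dotvC dotvZl dotvC. Qed.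

Lemma dotvNl u v : dotv (- u) v = - dotv u v.
Proof. by rewrite -scaleN1r dotvZl mulN1r. Qed.

Lemma dot0v v : dotv 0 v = 0.
Proof. by rewrite -(scale0r 0) dotvZl mul0r. Qed.

Lemma dotvv_ge0 u : 0 <= dotv u u.
Proof. by apply: sumr_ge0 => j _; rewrite -expr2 sqr_ge0. Qed.

Lemma enorm_ge0 u : 0 <= enorm u.
Proof. exact: sqrtr_ge0. Qed.

Lemma sqr_enorm u : enorm u ^+ 2 = dotv u u.
Proof. by rewrite sqr_sqrtr// dotvv_ge0. Qed.

Lemma sqr_enormD u v : enorm (u + v) ^+ 2 = enorm u ^+ 2 + 2 * dotv u v + enorm v ^+ 2.
Proof. by rewrite !sqr_enorm dotvDl !dotvDr (dotvC v u); ring. Qed.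

Lemma enormZ c u : enorm (c *: u) = `|c| * enorm u.
Proof.
by rewrite /enorm dotvZl dotvZr mulrA -expr2 sqrtrM ?sqr_ge0// sqrtr_sqr.
Qed.

Lemma enormN u : enorm (- u) = enorm u.
Proof. by rewrite -scaleN1r enormZ normrN1 mul1r. Qed.

Lemma enormB u v : enorm (u - v) = enorm (v - u).
Proof. by rewrite -enormN opprB. Qed.

Lemma enorm0 : enorm (0 : 'cV[R]_n) = 0.
Proof. by rewrite -(scale0r 0) enormZ normr0 mul0r. Qed.

Lemma sqr_enormZ c u : enorm (c *: u) ^+ 2 = c ^+ 2 * enorm u ^+ 2.
Proof. by rewrite enormZ exprMn real_normK// num_real. Qed.

Lemma coord_le_enorm u j : `|u j 0| <= enorm u.
Proof.
rewrite -sqrtr_sqr ler_wsqrtr// /dotv (bigD1 j)//= expr2 lerDl.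
by apply: sumr_ge0 => i _; rewrite -expr2 sqr_ge0.
Qed.

Lemma enorm_eq0 u : enorm u = 0 -> u = 0.
Proof.
move=> u0; apply/colP => j; rewrite mxE; apply/eqP.
by rewrite -normr_le0 -u0 coord_le_enorm.
Qed.

Lemma enorm_gt0 u : u != 0 -> 0 < enorm u.
Proof.
move=> u0; rewrite lt_def enorm_ge0 andbT.
by apply: contra u0 => /eqP /enorm_eq0 ->.
Qed.

(* Expand [|| |v| u - |u| v ||^2 >= 0]. *)
Lemma dotv_le u v : dotv u v <= enorm u * enorm v.
Proof.
have [->|u0] := eqVneq u 0; first by rewrite dot0v enorm0 mul0r.
have [->|v0] := eqVneq v 0; first by rewrite dotvC dot0v enorm0 mulr0.
have := sqr_ge0 (enorm (enorm v *: u + (- enorm u) *: v)).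
rewrite sqr_enormD !sqr_enormZ dotvZl dotvZr sqrrN.
have := enorm_gt0 u0; have := enorm_gt0 v0.
set p := enorm u; set q := enorm v; set s := dotv u v => q0 p0 h.
rewrite -(ler_pM2r (mulr_gt0 p0 q0)); move: h; nra.
Qed.

Lemma normr_dotv_le u v : `|dotv u v| <= enorm u * enorm v.
Proof.
by rewrite ler_norml dotv_le andbT lerNl -dotvNl -(enormN u) dotv_le.
Qed.

Lemma ler_enormD u v : enorm (u + v) <= enorm u + enorm v.
Proof.
rewrite -(@ler_pXn2r _ 2)// ?nnegrE ?addr_ge0 ?enorm_ge0//.
by rewrite sqr_enormD; have := dotv_le u v; nra.
Qed.

Lemma ler_enorm_tri x u v : enorm (u - v) <= enorm (u - x) + enorm (x - v).
Proof. by have := ler_enormD (u - x) (x - v); rewrite addrA subrK. Qed.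

Lemma sqr_enormD_le u v : enorm (u + v) ^+ 2 <= 2 * enorm u ^+ 2 + 2 * enorm v ^+ 2.
Proof.
by rewrite sqr_enormD; have := dotv_le u v; have := sqr_ge0 (enorm u - enorm v); nra.
Qed.

Lemma norm_le_enorm u : `|u| <= enorm u.
Proof.
rewrite [leLHS]/Num.Def.normr/= mx_normrE; apply/bigmax_leP; split; first exact: enorm_ge0.
by case=> i j _ /=; rewrite (ord1 j) coord_le_enorm.
Qed.

Lemma coord_le_norm u j : `|u j 0| <= `|u|.
Proof.
rewrite [leRHS]/Num.Def.normr/= mx_normrE.
exact: (@le_bigmax _ _ _ 0 (fun ij => `|u ij.1 ij.2|) (j, 0)).
Qed.

Lemma enorm_le_norm u : enorm u <= n%:R * `|u|.
Proof.
rewrite -[leRHS]ger0_norm ?mulr_ge0// -sqrtr_sqr ler_wsqrtr// exprMn.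
apply: (@le_trans _ _ (\sum_(j < n) `|u| ^+ 2)).
  apply: ler_sum => j _; rewrite -expr2 -real_normK ?num_real//.
  by rewrite ler_pXn2r ?nnegrE// coord_le_norm.
rewrite sumr_const card_ord -[leLHS]mulr_natl ler_wpM2r ?sqr_ge0//.
by rewrite -natrX ler_nat; case: (n) => // k; rewrite expnS expn1 leq_pmulr.
Qed.

(** Holds because [|u| <= enorm u <= n |u|]; it lets every later limit argument use Euclidean balls
    in the sup-norm topology. *)
Lemma nbhs_enormP x (A : set 'cV[R]_n) : nbhs x A <->
  exists2 e : R, 0 < e & forall y, enorm (y - x) < e -> A y.
Proof.
split=> [/nbhs_normP[e /= e0 eA]|[e e0 eA]].
  exists e => // y yx; apply: eA => /=; rewrite -normrN opprB.
  exact: le_lt_trans (norm_le_enorm _) yx.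
have n0 : 0 < n%:R + 1 :> R by rewrite ltr_wpDl.
apply: (iffRL (nbhs_normP x A)); exists (e / (n%:R + 1)) => /=; first by rewrite divr_gt0.
move=> y /=; rewrite ltr_pdivlMr// -normrN opprB => yx; apply: eA.
apply: le_lt_trans (enorm_le_norm _) _; apply: le_lt_trans yx.
by rewrite mulrC ler_wpM2l// lerDl.
Qed.

Lemma cvg_enormP (T : Type) (F : set_system T) {FF : Filter F}
    (h : T -> 'cV[R]_n) x :
  h t @[t --> F] --> x <->
  forall e : R, 0 < e -> \forall t \near F, enorm (h t - x) < e.
Proof.
split=> [hx e e0|hx A /nbhs_enormP[e e0 eA]]; last first.
  by apply: filterS (hx e e0) => t; exact: eA.
by apply: (hx [set y | enorm (y - x) < e]); apply/nbhs_enormP; exists e.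
Qed.

Lemma cvg_enorm (T : Type) (F : set_system T) {FF : Filter F}
    (h : T -> 'cV[R]_n) x : h t @[t --> F] --> x ->
  enorm (h t) @[t --> F] --> enorm x.
Proof.
move/cvg_enormP => hx; apply/cvgrPdist_lt => e e0.
apply: filterS (hx e e0) => t; apply: le_lt_trans.
rewrite ler_norml; have := ler_enormD (h t - x) x; have := ler_enormD (x - h t) (h t).
by rewrite !subrK (enormB x) => h1 h2; apply/andP; split; lra.
Qed.

Lemma cvg_dotv (T : Type) (F : set_system T) {FF : Filter F}
    (h k : T -> 'cV[R]_n) x y :
  h t @[t --> F] --> x -> k t @[t --> F] --> y ->
  dotv (h t) (k t) @[t --> F] --> dotv x y.
Proof.
move=> hx ky.
(* Polarization reduces continuity of the inner product to continuity of the norm. *)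
have polar u v : dotv u v = 2^-1 * (enorm (u + v) ^+ 2 - enorm u ^+ 2 - enorm v ^+ 2).
  by rewrite sqr_enormD; field.
rewrite polar; under eq_fun do rewrite polar.
apply: cvgM; first exact: cvg_cst.
apply: cvgB; first apply: cvgB.
- by rewrite expr2; under eq_fun do rewrite expr2; apply: cvgM; apply: cvg_enorm; apply: cvgD.
- by rewrite expr2; under eq_fun do rewrite expr2; apply: cvgM; apply: cvg_enorm.
- by rewrite expr2; under eq_fun do rewrite expr2; apply: cvgM; apply: cvg_enorm.
Qed.

Lemma cvg_sqr_enorm (T : Type) (F : set_system T) {FF : Filter F}
    (h : T -> 'cV[R]_n) x : h t @[t --> F] --> x ->
  enorm (h t) ^+ 2 @[t --> F] --> enorm x ^+ 2.
Proof.
by move=> hx; rewrite sqr_enorm; under eq_fun do rewrite sqr_enorm; exact: cvg_dotv.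
Qed.

End Euclidean.

(** * Block decomposition of vectors, inner products and norms *)

Section Blocks.
Context (R : realType) (N : nat) (n_ : 'I_N -> nat).
Local Notation V := 'cV[R]_(\sum_(j < N) n_ j).
Implicit Types (x y d : V) (i : 'I_N).

Lemma blkE i x : blk i x = submxcol x i.
Proof. by rewrite /blk /Umx tr_submxrow trmx1 submxcol_mul mul1mx. Qed.

Lemma blkD i x y : blk i (x + y) = blk i x + blk i y.
Proof. exact: mulmxDr. Qed.

Lemma blkB i x y : blk i (x - y) = blk i x - blk i y.
Proof. exact: mulmxBr. Qed.

Lemma sum_Umx_blk x : x = \sum_i Umx R n_ i *m blk i x.
Proof.
rewrite -mul_mxrow_mxcol submxrowK mul1mx -[LHS]submxcolK.
by apply/eq_mxcolP => i; rewrite blkE.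
Qed.

Lemma Umx_blk i d : (forall j, j != i -> blk j d = 0) ->
  d = Umx R n_ i *m blk i d.
Proof.
move=> d0; apply: etrans (sum_Umx_blk d) _; apply: etrans (bigD1 i _) _ => //=.
apply: etrans (addr0 _); congr +%R; apply: big1 => j /d0 ->.
by rewrite mulmx0.
Qed.

Lemma dotv_blk x y : dotv x y = \sum_i dotv (blk i x) (blk i y).
Proof.
have dotvE k (u v : 'cV[R]_k) : dotv u v = (u^T *m v) 0 0.
  by rewrite mxE; apply: eq_bigr => j _; rewrite mxE.
rewrite dotvE -[x in LHS]submxcolK -[y in LHS]submxcolK tr_mxcol mul_mxrow_mxcol.
by rewrite summxE; apply: eq_bigr => i _; rewrite dotvE !blkE.
Qed.

Lemma enorm_blk_le i x : enorm (blk i x) <= enorm x.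
Proof.
rewrite ler_wsqrtr// dotv_blk (bigD1 i)//= lerDl.
by apply: sumr_ge0 => j _; exact: dotvv_ge0.
Qed.

Lemma sqr_enorm_blk x : enorm x ^+ 2 = \sum_i enorm (blk i x) ^+ 2.
Proof. by rewrite sqr_enorm dotv_blk; apply: eq_bigr => i _; rewrite sqr_enorm. Qed.

Lemma dotv_supp i x d : (forall j, j != i -> blk j d = 0) ->
  dotv x d = dotv (blk i x) (blk i d).
Proof.
move=> d0; rewrite dotv_blk (bigD1 i)//= big1 ?addr0// => j /d0 ->.
by rewrite dotvC dot0v.
Qed.

Lemma enorm_supp i d : (forall j, j != i -> blk j d = 0) ->
  enorm d = enorm (blk i d).
Proof. by move=> d0; rewrite /enorm (dotv_supp _ d0). Qed.

Lemma cvg_blk (T : Type) (F : set_system T) {FF : Filter F} (h : T -> V) x i :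
  h t @[t --> F] --> x -> blk i (h t) @[t --> F] --> blk i x.
Proof.
move=> /cvg_enormP hx; apply/cvg_enormP => e e0; apply: filterS (hx e e0) => t.
by apply: le_lt_trans; rewrite -blkB enorm_blk_le.
Qed.

End Blocks.

(** * First-order expansion and mean value theorem *)

Section Differentiable.
Context (R : realType) (n : nat) (f : 'cV[R]_n -> R).
Implicit Types (x y s : 'cV[R]_n).

Lemma diff_grad x s : differentiable (f : 'cV[R]_n -> R^o) x ->
  'd (f : 'cV[R]_n -> R^o) x s = dotv (grad f x) s.
Proof.
move=> df; rewrite [s in LHS]matrix_sum_delta.
rewrite linear_sum; apply: eq_bigr => j _; rewrite big_ord1 linearZ mxE -deriveE//.
by rewrite [LHS]mulrC.
Qed.

Lemma differentiable_eps x (e : R) : differentiable (f : 'cV[R]_n -> R^o) x ->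
  0 < e ->
  \forall y \near x, `|f y - f x - dotv (grad f x) (y - x)| <= e * enorm (y - x).
Proof.
move=> df e0.
have /eqaddoP/(_ _ e0) /nbhs_normP[r /= r0 rP] := diff_locally df.
apply/nbhs_normP; exists r => //= y /=; rewrite -normrN opprB => yr.
have := rP (y - x); rewrite /= sub0r normrN => /(_ yr).
rewrite !fctE /= subrK diff_grad// opprD addrA => /le_trans; apply.
by rewrite ler_pM2l// norm_le_enorm.
Qed.

Lemma mean_value x s :
  (forall y, differentiable (f : 'cV[R]_n -> R^o) y) ->
  exists2 t : R, 0 <= t <= 1 & f (x + s) - f x = dotv (grad f (x + t *: s)) s.
Proof.
move=> df.
pose h (t : R) : R^o := f (x + t *: s).
have dh (t : R) : is_derive (t : R^o) 1 h (dotv (grad f (x + t *: s)) s).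
  (* The difference quotient of [h] at [t] is that of [f] at [x + t *: s] in the direction [s]. *)
  have dq : (fun e : R => e^-1 *: ((h \o shift t) (e *: 1) - h t)) =
            (fun e : R => e^-1 *: (((f : _ -> R^o) \o shift (x + t *: s)) (e *: s)
                           - f (x + t *: s))).
    apply/funext => e; rewrite /h /=; congr (_ *: (f _ - _)).
    by rewrite scalerDl [e *: 1]mulr1 addrCA.
  split; first by rewrite /derivable dq; exact: diff_derivable.
  by rewrite /derive dq -diff_grad// -deriveE.
have hc : {within `[0, 1], continuous h}.
  by apply: derivable_within_continuous => t _; apply: ex_derive.
have [t] := MVT_segment ler01 (fun t _ => dh t) hc.
by rewrite /h scale1r scale0r addr0 subr0 mulr1 => t01; exists t.
Qed.

End Differentiable.

(** * Calculus of the regular subdifferential *)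

Section Subdifferential.
Context (R : realType) (n : nat).
Implicit Types (f : 'cV[R]_n -> R) (h : 'cV[R]_n -> \bar R) (x v : 'cV[R]_n).

Lemma littleo_enormP (r : 'cV[R]_n -> R^o) x :
  r =o_x (fun y => enorm (y - x) : R^o) <->
  forall e : R, 0 < e -> \forall y \near x, `|r y| <= e * enorm (y - x).
Proof.
by split=> [/eqoP ro e e0|ro]; [have := ro _ e0 | apply/eqoP => e e0; have := ro _ e0];
  apply: filterS => y; rewrite (ger0_norm (enorm_ge0 (y - x))).
Qed.

(** The first-order remainder of [f] is itself [o(|y - x|)] and is absorbed in the remainder of the
    subgradient inequality. *)
Lemma subdiffD_diff f h x v : differentiable (f : 'cV[R]_n -> R^o) x ->
  subdiff h x v -> subdiff (fun y => ((f y)%:E + h y)%E) x (grad f x + v).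
Proof.
move=> df [hx [r [ro rP]]]; split; first by rewrite fin_numD hx.
exists (fun y => r y + (f y - f x - dotv (grad f x) (y - x))); split.
  apply/littleo_enormP => e e0; have e20 : 0 < e / 2 by rewrite divr_gt0.
  have := differentiable_eps df e20; move/littleo_enormP : ro => /(_ _ e20).
  apply: filterS2 => y /= h1 h2; rewrite (le_trans (ler_normD _ _))//.
  by rewrite [e]splitr mulrDl lerD.
apply: filterS rP => y; move: hx; case: (h x) => // c _; case: (h y) => [c'||]//=.
- by rewrite !lee_fin !dotvDl; lra.
- by rewrite addey// ?leey.
Qed.

Lemma gradN f x : differentiable (f : 'cV[R]_n -> R^o) x ->
  grad (fun y => - f y) x = - grad f x.
Proof.
move=> df; apply/colP => j; rewrite !mxE.
by apply: (@deriveN _ _ _ (f : 'cV[R]_n -> R^o)); exact: diff_derivable.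
Qed.

(** The forward direction recovers [h] by adding [- f] to [f + h], so the sum rule for a
    differentiable summand gives both implications. *)
Lemma stationaryD f h x : differentiable (f : 'cV[R]_n -> R^o) x ->
  stationary (fun y => ((f y)%:E + h y)%E) x <->
  exists2 v, subdiff h x v & grad f x + v = 0.
Proof.
move=> df; split=> [[_ sx]|[v vx xv]]; last first.
  have := subdiffD_diff df vx; rewrite xv => s0; split=> //.
  by case: s0.
exists (- grad f x); last by rewrite subrr.
have dNf : differentiable ((fun y => - f y) : 'cV[R]_n -> R^o) x.
  exact: (@differentiableN _ _ _ (f : 'cV[R]_n -> R^o)).
have := subdiffD_diff dNf sx; rewrite addr0 gradN//.
suff -> : (fun y => (- f y)%:E + ((f y)%:E + h y))%E = h by [].
by apply/funext => y; rewrite addeA -EFinD addNr add0e.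
Qed.

(** A quadratic error is [o(|y - x|)]; this turns limits of prox inequalities into subgradients. *)
Lemma subdiff_quadratic h x v (C : R) : h x \is a fin_num ->
  (forall y, (h x + (dotv v (y - x) - C * enorm (y - x) ^+ 2)%:E <= h y)%E) ->
  subdiff h x v.
Proof.
move=> hx hC; split=> //; exists (fun y => - (C * enorm (y - x) ^+ 2)); split.
  apply/littleo_enormP => e e0; apply/nbhs_enormP; exists (e / (`|C| + 1)).
    by rewrite divr_gt0// ltr_wpDl.
  move=> y; rewrite ltr_pdivlMr ?ltr_wpDl// => yx.
  rewrite normrN normrM (ger0_norm (sqr_ge0 _)) expr2 mulrA ler_wpM2r ?enorm_ge0//.
  apply: le_trans (ltW yx).
  by rewrite mulrC ler_wpM2l ?enorm_ge0// lerDl.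
by apply: filterE => y; exact: hC.
Qed.

End Subdifferential.

(** * The inequality carried by a prox step *)

Section Prox.
Context (R : realType) (N : nat) (n_ : 'I_N -> nat).
Local Notation V := 'cV[R]_(\sum_(j < N) n_ j).
Context (f : V -> R) (g : forall i : 'I_N, 'cV[R]_(n_ i) -> \bar R).
Arguments g : clear implicits.
Hypothesis g_proper : forall i, Defs.proper (g i).

(** Expanding both squares around [blk i x], the term [tau ^+ 2 * enorm gr ^+ 2] cancels, and
    dividing by [tau] leaves a linear model of [f] with a proximal term. *)
Lemma prox_direction_le i tau x d (w : 'cV[R]_(n_ i)) : 0 < tau ->
  prox_direction f g i tau x d ->
  (g i (blk i x + blk i d)
     + (dotv (blk i (grad f x)) (blk i d) + (2 * tau)^-1 * enorm d ^+ 2)%:E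
   <= g i w + (dotv (blk i (grad f x)) (w - blk i x)
               + (2 * tau)^-1 * enorm (w - blk i x) ^+ 2)%:E)%E.
Proof.
move=> tau0 [d0 /(_ w)]; rewrite (enorm_supp d0).
set gr := blk i (grad f x); set xi := blk i x; set di := blk i d.
have sq u : enorm (xi - tau *: gr - u) ^+ 2
    = tau ^+ 2 * enorm gr ^+ 2 + 2 * tau * dotv gr (u - xi) + enorm (u - xi) ^+ 2.
  have -> : xi - tau *: gr - u = - (tau *: gr + (u - xi)).
    by rewrite opprD opprB addrAC addrC.
  by rewrite enormN sqr_enormD sqr_enormZ dotvZl; ring.
rewrite !sq [xi + di - xi]addrAC subrr add0r.
have /proj1 gN := g_proper i.
case: (g i w) (gN w) => [c _||//]; last by move=> _ _; rewrite addye// leey.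
case: (g i (xi + di)) (gN (xi + di)) => [b _||//]; last first.
  by move=> _; rewrite mulry gtr0_sg// mul1e addye.
rewrite -!EFinM -!EFinD !lee_fin => h.
set p := dotv _ _ in h *; set q := dotv _ _ in h *.
have t20 : 0 < 2 * tau by rewrite mulr_gt0.
rewrite -(ler_pM2l t20) !mulrDr !mulrA mulfV ?gt_eqF// !mul1r.
by lra.
Qed.

End Prox.

(** * Acceptance of small stepsizes by the backtracking *)

Section LineSearch.
Context (R : realType) (N : nat) (n_ : 'I_N -> nat).
Local Notation V := 'cV[R]_(\sum_(j < N) n_ j).
Context (f : V -> R) (g : forall i : 'I_N, 'cV[R]_(n_ i) -> \bar R).
Arguments g : clear implicits.
Hypothesis f_diff : forall x, differentiable (f : V -> R^o) x.
Hypothesis grad_cont : continuous (grad f).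
Hypothesis g_proper : forall i, Defs.proper (g i).
Hypothesis g_prox_bounded : forall i, prox_bounded (g i).

Lemma gsumD1 i x :
  gsum g x = (g i (blk i x) + \sum_(j < N | j != i) g j (blk j x))%E.
Proof. exact: (bigD1 i). Qed.

(** Summing the constants of the individual blocks gives one quadratic minorant valid for all of
    them. *)
Lemma prox_bounded_lower : exists M c : R, [/\ 0 <= M, 0 <= c &
  forall i u, ((- (M + c * enorm u ^+ 2))%:E <= g i u)%E].
Proof.
have /choice[M] : forall i, exists Mc : R * R, 0 <= Mc.2 /\
    forall u, ((- (Mc.1 + Mc.2 * enorm u ^+ 2))%:E <= g i u)%E.
  move=> i; have [tau tau0 [m mP]] := g_prox_bounded i.
  exists (- m, (2 * tau)^-1); split; first by rewrite /= invr_ge0 mulr_ge0// ltW.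
  move=> u; have := mP u; case: (g i u) => [r||].
  - by rewrite -EFinD !lee_fin /=; lra.
  - by move=> _; rewrite leey.
  - by [].
move=> MP; exists (\sum_i `|(M i).1|), (\sum_i (M i).2); split.
- by apply: sumr_ge0.
- by apply: sumr_ge0 => i _; case: (MP i).
move=> i u; have [_ /(_ u)] := MP i; apply: le_trans; rewrite lee_fin lerN2.
apply: lerD.
  apply: le_trans (ler_norm _) _; rewrite (bigD1 i)//= lerDl.
  by apply: sumr_ge0.
rewrite ler_wpM2r ?sqr_ge0// (bigD1 i)//= lerDl.
by apply: sumr_ge0 => j _; case: (MP j).
Qed.

(** An upper bound on the whole objective limits each [g i] from above, since [f] and the other
    blocks are bounded below near [xb]. *)
Lemma block_bound (xb : V) (c0 : R) : exists C : R, \forall y \near xb,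
  (phi f g y <= c0%:E)%E -> forall i, (g i (blk i y) <= C%:E)%E.
Proof.
have [M [c [M0 c_ge0 lowg]]] := prox_bounded_lower.
(* On the unit ball around [xb] each block contributes at least [- K], and [f] exceeds [f xb - 1]
   close to [xb]. *)
pose B := enorm xb + 1; pose K := M + c * B ^+ 2.
have K0 : 0 <= K by rewrite addr_ge0// mulr_ge0// sqr_ge0.
exists (c0 - f xb + 1 + N%:R * K).
have fc : \forall y \near xb, `|f xb - f y| < 1.
  by have /cvgrPdist_lt := differentiable_continuous (f_diff xb); apply.
have yB : \forall y \near xb, enorm (y - xb) < 1.
  by apply/nbhs_enormP; exists 1.
apply: filterS2 fc yB => y; rewrite ltr_norml => /andP[_ fy] yB phiy i.
have gK j : ((- K)%:E <= g j (blk j y))%E.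
  apply: le_trans (lowg j _); rewrite lee_fin lerN2 lerD2l ler_wpM2l//.
  rewrite ler_pXn2r ?nnegrE ?enorm_ge0 ?addr_ge0 ?enorm_ge0//.
  apply: le_trans (enorm_blk_le _ _) _.
  by have := ler_enormD (y - xb) xb; rewrite subrK /B; lra.
have : ((- (N%:R * K))%:E <= \sum_(j < N | j != i) g j (blk j y))%E.
  apply: (@le_trans _ _ (\sum_(j < N | j != i) (- K)%:E)%E); last exact: lee_sum.
  rewrite sumEFin lee_fin sumr_const -mulrN -[leRHS]mulr_natl.
  rewrite ler_wnM2r ?oppr_le0// ler_nat.
  by apply: leq_trans (max_card _) _; rewrite card_ord.
move: phiy; rewrite /phi (gsumD1 i).
case: (\sum_(j < N | j != i) _)%E => [s||]//=; last first.
  by have := gK i; case: (g i (blk i y)) => [r||]//=.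
case: (g i (blk i y)) => [r||]//=; last by move=> *; rewrite leNye.
by rewrite -!EFinD !lee_fin => *; lra.
Qed.

(* The mean value theorem yields the constant [L] rather than the sharp [L / 2],
   which is enough here. *)
Lemma block_descent i (W : set V) (L : R) (x d : V) :
  0 < L ->
  (forall (y : V) (s : 'cV[R]_(n_ i)), W y -> W (y + Umx R n_ i *m s) ->
     enorm (blk i (grad f (y + Umx R n_ i *m s)) - blk i (grad f y))
       <= L * enorm s) ->
  (forall t : R, 0 <= t <= 1 -> W (x + t *: d)) ->
  (forall j, j != i -> blk j d = 0) ->
  f (x + d) <= f x + dotv (blk i (grad f x)) (blk i d) + L * enorm d ^+ 2.
Proof.
move=> L0 Llip Wd d0.
have [t t01] := mean_value x d f_diff; rewrite (dotv_supp _ d0) => fd.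
have Wx : W x by have := Wd 0; rewrite scale0r addr0; apply; rewrite lexx ler01.
have dE : Umx R n_ i *m (t *: blk i d) = t *: d.
  by rewrite -scalemxAr -Umx_blk.
have := Llip x (t *: blk i d) Wx; rewrite dE => /(_ (Wd _ t01)) h.
have : dotv (blk i (grad f (x + t *: d)) - blk i (grad f x)) (blk i d)
     <= L * enorm d ^+ 2.
  apply: le_trans (dotv_le _ _) _.
  rewrite (enorm_supp d0) expr2 mulrA ler_wpM2r ?enorm_ge0//.
  apply: le_trans h _; rewrite enormZ (ler_wpM2l (ltW L0))// ler_piMl ?enorm_ge0//.
  by case/andP: t01 => t0 t1; rewrite ger0_norm.
by rewrite dotvDl dotvNl; lra.
Qed.

(* For a small stepsize the prox direction is short, since [g i] is bounded
   below by a concave quadratic, and then the block gradient is Lipschitz along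
   the whole step. *)
Lemma small_step_sufficient_decrease (a c0 : R) (xb : V) :
  block_locally_lipschitz f (dom (gsum g)) -> dom (gsum g) xb ->
  exists2 tau0 : R, 0 < tau0 & \forall y \near xb, (phi f g y <= c0%:E)%E ->
    forall i tau d, 0 < tau <= tau0 -> prox_direction f g i tau y d ->
    sufficient_decrease f g a y d.
Proof.
move=> lip /lip[W [L WL]].
have [C gC] := block_bound xb c0.
have [M [c [M0 c_ge0 lowg]]] := prox_bounded_lower.
have /choice[e eP] : forall i, exists e : R, 0 < e /\ forall y, enorm (y - xb) < e -> W i y.
  move=> i; have [/nbhs_enormP[e e0 eW] _ _ _] := WL i.
  by exists e.
(* [G] and [B] bound the gradient and the point near [xb]. [K] strictly dominates the constant terms
   of the prox inequality, and [rho^-1] is at most half of every radius [e i]. *)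
pose G := enorm (grad f xb) + 1; pose B := enorm xb + 1.
pose K := `|C + M + 2 * c * B ^+ 2 + G ^+ 2 / 2| + 1.
have K0 : 0 < K by rewrite ltr_wpDl.
pose Li := \sum_i L i; pose rho := \sum_i (e i / 2)^-1 + 1.
have rho_ge i : (e i / 2)^-1 <= rho.
  rewrite /rho (bigD1 i)//= -addrA lerDl addr_ge0//; apply: sumr_ge0 => j _.
  by have [e0 _] := eP j; rewrite invr_ge0 divr_ge0// ltW.
have rho0 : 0 < rho.
  rewrite ltr_wpDl//; apply: sumr_ge0 => j _.
  by have [e0 _] := eP j; rewrite invr_ge0 divr_ge0// ltW.
have L_le i : L i <= Li.
  rewrite /Li (bigD1 i)//= lerDl; apply: sumr_ge0 => j _.
  by have [_ _ /ltW] := WL j.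
have Li0 : 0 <= Li by apply: sumr_ge0 => j _; have [_ _ /ltW] := WL j.
(* [D] adds up what [(2 * tau)^-1] must beat: [2 * c + 2^-1] and [K * rho ^+ 2] to force
   [enorm d < rho^-1], then [Li + |a|] to obtain the decrease. *)
pose D := 2 * c + 2^-1 + K * rho ^+ 2 + Li + `|a| + 1.
have D0 : 0 < D.
  have := mulr_ge0 (ltW K0) (sqr_ge0 rho); have := normr_ge0 a.
  by rewrite /D; lra.
exists (2 * D)^-1; first by rewrite invr_gt0 mulr_gt0.
have gradG : \forall y \near xb, enorm (grad f y - grad f xb) < 1.
  have /cvg_enormP : grad f y @[y --> xb] --> grad f xb by exact: grad_cont.
  exact.
have yrho : \forall y \near xb, enorm (y - xb) < rho^-1 /\ enorm (y - xb) < 1.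
  apply/nbhs_enormP; exists (Num.min rho^-1 1); first by rewrite lt_min invr_gt0 rho0 ltr01.
  by move=> y; rewrite lt_min => /andP[].
apply: filterS3 gC gradG yrho => y gC Gy [yrho y1] phiy i tau d /andP[tau0 tauD] pd.
have d0 := pd.1.
have tD : D <= (2 * tau)^-1.
  by rewrite -(invrK D) lef_pV2 ?posrE ?invr_gt0 ?mulr_gt0//; move: tauD; rewrite invfM; lra.
(* The competitor is the zero step, [w = blk i y]. *)
have := prox_direction_le g_proper (blk i y) tau0 pd.
rewrite subrr [dotv _ 0]dotvC dot0v enorm0 expr0n/= mulr0 addr0 adde0.
move=> three.
have dB : dotv (blk i (grad f y)) (blk i d) >= - (G ^+ 2 / 2 + enorm d ^+ 2 / 2).
  have := normr_dotv_le (blk i (grad f y)) (blk i d).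
  rewrite -(enorm_supp d0) ler_norml => /andP[+ _]; apply: le_trans; rewrite lerN2.
  have gG : enorm (blk i (grad f y)) <= G.
    apply: le_trans (enorm_blk_le _ _) _.
    by have := ler_enormD (grad f y - grad f xb) (grad f xb); rewrite subrK /G; lra.
  have := sqr_ge0 (G - enorm d).
  by have := ler_wpM2r (enorm_ge0 d) gG; nra.
have yB : enorm y <= B.
  by have := ler_enormD (y - xb) xb; rewrite subrK /B; lra.
have uB : enorm (blk i y + blk i d) ^+ 2 <= 2 * B ^+ 2 + 2 * enorm d ^+ 2.
  rewrite -blkD; apply: le_trans (_ : enorm (y + d) ^+ 2 <= _).
    by rewrite ler_pXn2r ?nnegrE ?enorm_ge0// enorm_blk_le.
  apply: le_trans (sqr_enormD_le _ _) _; rewrite lerD2r ler_wpM2l//.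
  by rewrite ler_pXn2r ?nnegrE ?enorm_ge0// (le_trans (enorm_ge0 y)).
have d_small : enorm d < rho^-1.
  have lu := lowg i (blk i y + blk i d).
  have h : (2 * tau)^-1 * enorm d ^+ 2 <= C + M + 2 * c * B ^+ 2 + G ^+ 2 / 2
      + (2 * c + 2^-1) * enorm d ^+ 2.
    move: three lu (gC phiy i).
    case: (g i (blk i y + blk i d)) => [r||]//=; case: (g i (blk i y)) => [r'||]//=.
    rewrite -!EFinD !lee_fin => h1 h2 h3.
    by have := ler_wpM2l c_ge0 uB; lra.
  have hK : K * rho ^+ 2 * enorm d ^+ 2 < K.
    have := ler_wpM2r (sqr_ge0 (enorm d)) tD.
    have := ler_norm (C + M + 2 * c * B ^+ 2 + G ^+ 2 / 2).
    have := mulr_ge0 Li0 (sqr_ge0 (enorm d)).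
    have := mulr_ge0 (normr_ge0 a) (sqr_ge0 (enorm d)).
    have : K = `|C + M + 2 * c * B ^+ 2 + G ^+ 2 / 2| + 1 by [].
    by have := sqr_ge0 (enorm d); rewrite /D; lra.
  have : (rho * enorm d) ^+ 2 < 1.
    by rewrite exprMn -(ltr_pM2l K0) mulr1 mulrA.
  rewrite expr_lt1// ?mulr_ge0 ?enorm_ge0 ?ltW// => h'.
  by rewrite -(ltr_pM2l rho0) mulfV ?gt_eqF.
(* Both [y - xb] and [d] are shorter than [rho^-1], so the whole segment stays within [e i] of
   [xb]. *)
have Wd t : 0 <= t <= 1 -> W i (y + t *: d).
  move=> /andP[t0 t1]; have [e0] := eP i; apply; rewrite -addrAC.
  apply: le_lt_trans (ler_enormD _ _) _; rewrite enormZ ger0_norm//.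
  have : rho^-1 <= e i / 2.
    by rewrite -[leRHS]invrK lef_pV2 ?posrE ?invr_gt0 ?divr_gt0//.
  by have := ler_wpM2r (enorm_ge0 d) t1; lra.
have [_ _ Li_gt0 lipi] := WL i.
have fd := block_descent Li_gt0 lipi Wd d0.
rewrite /sufficient_decrease /phi !(gsumD1 i) blkD.
have -> : (\sum_(j < N | j != i) g j (blk j (y + d)) =
           \sum_(j < N | j != i) g j (blk j y))%E.
  by apply: eq_bigr => j ji; rewrite blkD d0// addr0.
have sN : (\sum_(j < N | j != i) g j (blk j y) != -oo)%E.
  by apply/eqP => /esum_eqNyP[j [_ _ /eqP]]; apply/negP; case: (g_proper j).
move: three (gC phiy i) sN.
case: (\sum_(j < N | j != i) _)%E => [s||]//=;
  case: (g i (blk i y + blk i d)) => [r||]//=;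
  case: (g i (blk i y)) => [r'||]//=; last by move=> *; rewrite leNye.
rewrite -!EFinD !lee_fin => h1 h2 _.
have h3 := ler_wpM2r (sqr_ge0 (enorm d)) tD.
have h4 := ler_wpM2r (sqr_ge0 (enorm d)) (L_le i).
have h5 := ler_wpM2r (sqr_ge0 (enorm d)) (ler_norm a).
have h6 := mulr_ge0 (mulr_ge0 (ltW K0) (sqr_ge0 rho)) (sqr_ge0 (enorm d)).
have h7 := mulr_ge0 c_ge0 (sqr_ge0 (enorm d)).
have h8 := sqr_ge0 (enorm d).
move: h3; rewrite {1}/D; lra.
Qed.

End LineSearch.

(** * Cluster points of sequences *)

Section Cluster.
Context (R : realType) (n : nat).
Implicit Types (x : nat -> 'cV[R]_n) (xs : 'cV[R]_n).

(** The choice [u] is only minorized by the identity, not increasing, which is enough for it to tend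
    to infinity. *)
Lemma cluster_subseq x xs : cluster (x @ \oo) xs ->
  exists u : nat -> nat, (forall m, (m <= u m)%N) /\ x (u m) @[m --> \oo] --> xs.
Proof.
move=> xxs.
have /choice[u uP] : forall m, exists k, (m <= k)%N /\ enorm (x k - xs) < m.+1%:R^-1.
  move=> m.
  have [||y [/= [k mk <-] kxs]] := xxs [set x k | k in [set k | (m <= k)%N]]
      [set y | enorm (y - xs) < m.+1%:R^-1].
  - by exists m => // k /= mk; exists k.
  - by apply/nbhs_enormP; exists m.+1%:R^-1 => //; rewrite invr_gt0.
  by exists k.
exists u; split; first by move=> m; case: (uP m).
apply/cvg_enormP => e e0; near=> m; apply: lt_trans (proj2 (uP m)) _.
by near: m; exact: near_infty_natSinv_lt (PosNum e0).
Unshelve. all: by end_near. Qed.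

Lemma cvg_minorized_subseq (u : nat -> nat) : (forall m, (m <= u m)%N) ->
  u m @[m --> \oo] --> \oo.
Proof.
by move=> um A [k _ kA]; exists k => // m /= km; apply: kA; exact: leq_trans (um m).
Qed.

Lemma normr_trmx_le m p (A : 'M[R]_(m, p)) : `|A^T| <= `|A|.
Proof.
rewrite [leLHS]/Num.Def.normr/= mx_normrE; apply/bigmax_leP; split=> // -[i j] _ /=.
rewrite mxE [leRHS]/Num.Def.normr/= mx_normrE.
exact: (@le_bigmax _ _ _ 0 (fun ij => `|A ij.1 ij.2|) (j, i)).
Qed.

(** Compactness of a closed bounded set of row vectors, transported through transposition, which
    does not increase the sup norm. *)
Lemma bounded_cluster x (M : R) : (forall k, enorm (x k) <= M) ->
  exists q, cluster (x @ \oo) q.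
Proof.
move=> xM; pose A := [set v : 'rV[R]_n | `|v| <= M].
have Ac : compact A.
  apply: bounded_closed_compact.
    exists M; split; first exact: num_real.
    by move=> r Mr v /= vM; exact: le_trans vM (ltW Mr).
  apply: (preimage_closed _ (@closed_le _ M)) => v _; exact: norm_continuous.
have [|q [_ qx]] := Ac ((fun k => (x k)^T) @ \oo) (fmap_proper_filter _ _).
  exists 0%N => // k _ /=; apply: le_trans (normr_trmx_le _) _.
  exact: le_trans (norm_le_enorm _) (xM k).
exists q^T => P Q xP /nbhs_normP[e /= e0 eQ].
have [||v [/= [k Pk <-] kq]] := qx [set (x k)^T | k in x @^-1` P] [set v | `|q - v| < e].
- by have [K _ KP] := xP; exists K => // k /KP Pk; exists k.
- by apply: (iffRL (nbhs_normP q _)); exists e.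
exists (x k); split=> //; apply: eQ => /=; apply: le_lt_trans kq.
by rewrite -[leRHS]normrN -{1}(trmxK (x k)) -linearB/= normrN normr_trmx_le.
Qed.

(* Infinitely many visits to an annulus [s / 2 <= |y - xs| <= s] would produce a
   second cluster point there; so once the steps are shorter than [s / 2], the
   sequence cannot leave the ball of radius [s / 2]. *)
Lemma isolated_cluster_cvg x xs : isolated (cluster (x @ \oo)) xs ->
  enorm (x k.+1 - x k) @[k --> \oo] --> (0 : R) ->
  x @ \oo --> xs.
Proof.
move=> [xs_cl [W /nbhs_enormP[r r0 rW] Wxs]] step0.
have {}xs_cl : cluster (x @ \oo) xs by exact: set_mem.
apply/cvg_enormP => e e0.
pose s := Num.min e r / 2.
have s0 : 0 < s by rewrite divr_gt0// lt_min e0.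
have [se sr] : 2 * s <= e /\ 2 * s <= r.
  by rewrite /s mulrC divfK//; split; rewrite ge_min lexx ?orbT.
have s2r : s / 2 + s / 2 < r by lra.
have noann : \forall k \near \oo, ~ (s / 2 <= enorm (x k - xs) <= s).
  apply: contrapT => ann.
  have /choice[u uP] : forall m, exists k, (m <= k)%N /\ s / 2 <= enorm (x k - xs) <= s.
    move=> m; apply: contrapT => nk; apply: ann; exists m => // k /= mk xk.
    by apply: nk; exists k.
  have [|q qu] := @bounded_cluster (x \o u) (enorm xs + s).
    move=> m /=; have := ler_enormD (x (u m) - xs) xs; rewrite subrK.
    by have [_ /andP[_]] := uP m; lra.
  have qball (e' : R) m : 0 < e' -> exists k, (m <= k)%N /\ enorm (x (u k) - q) < e'.
    move=> e'0.
    have [||y [/= [k mk <-] kxs]] := qu [set x (u k) | k in [set k | (m <= k)%N]]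
        [set y | enorm (y - q) < e'].
    - by exists m => // k /= mk; exists k.
    - by apply/nbhs_enormP; exists e'.
    by exists k.
  (* The annulus lies in the isolating ball of [xs], so the cluster point [q] must be [xs]; yet the
     visits [x (u k)] stay [s / 2] away from [xs]. *)
  have qxs : q = xs.
    have : [set xs] q; last by [].
    rewrite -Wxs; split.
      apply: rW; have [k [_ xq]] := qball (s / 2) 0%N (divr_gt0 s0 (ltr0Sn _ _)).
      have := ler_enorm_tri (x (u k)) q xs; rewrite (enormB q (x (u k))).
      by have [_ /andP[_]] := uP k; lra.
    move=> A B [k0 _ k0A] /nbhs_enormP[e' e'0 eB].
    have [k [kk0 kq]] := qball e' k0 e'0.
    exists (x (u k)); split; last exact: eB.
    by apply: k0A => /=; have [ku _] := uP k; exact: leq_trans ku.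
  have [k [_]] := qball (s / 2) 0%N (divr_gt0 s0 (ltr0Sn _ _)).
  by rewrite qxs; have [_ /andP[+ _]] := uP k; lra.
have steps : \forall k \near \oo, enorm (x k.+1 - x k) < s / 2.
  move/cvgr0Pnorm_lt : step0 => /(_ (s / 2)); rewrite divr_gt0// => /(_ isT).
  by apply: filterS => k; rewrite ger0_norm ?enorm_ge0.
have [K _ KP] := filterI noann steps.
have [|| y [/= [k Kk <-] kxs]] := xs_cl [set x k | k in [set k | (K <= k)%N]]
      [set y | enorm (y - xs) < s / 2].
- by exists K => // k /= Kk; exists k.
- by apply/nbhs_enormP; exists (s / 2) => //; rewrite divr_gt0.
(* From the ball of radius [s / 2] one step reaches at most distance [s]; the annulus being
   excluded, the iterate is back in the small ball. *)
have stay j : (k <= j)%N -> enorm (x j - xs) < s / 2.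
  elim: j => [|j IH]; first by rewrite leqn0 => /eqP k0; move: kxs; rewrite k0.
  rewrite leq_eqVlt => /orP[/eqP kE|kj]; first by move: kxs; rewrite kE.
  have {}IH := IH kj.
  have [_ st] := KP j (leq_trans Kk kj).
  have [nA _] := KP j.+1 (leq_trans Kk (leqW kj)).
  rewrite ltNge; apply/negP => h; apply: nA; rewrite h/=.
  by have := ler_enorm_tri (x j) (x j.+1) xs; move: st IH; lra.
exists k => // j /= kj; apply: lt_le_trans (stay j kj) _.
by lra.
Qed.

End Cluster.

(** * Passage to the limit in the prox inequalities *)

Section Stationarity.
Context (R : realType) (N : nat) (n_ : 'I_N -> nat).
Local Notation V := 'cV[R]_(\sum_(j < N) n_ j).
Context (f : V -> R) (g : forall i : 'I_N, 'cV[R]_(n_ i) -> \bar R).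
Arguments g : clear implicits.
Hypothesis f_diff : forall x, differentiable (f : V -> R^o) x.
Hypothesis grad_cont : continuous (grad f).
Hypothesis g_proper : forall i, Defs.proper (g i).
Hypothesis g_lsc : forall i, lower_semicontinuous (g i).
Hypothesis g_prox_bounded : forall i, prox_bounded (g i).
Hypothesis f_lip : block_locally_lipschitz f (dom (gsum g)).

(** Were [g i] infinite at the limit, lower semicontinuity would push it above the bound [C] valid
    along the sequence. *)
Lemma cluster_dom (x : nat -> V) (xs : V) (c0 : R) :
  (forall k, (phi f g (x k) <= c0%:E)%E) -> x k @[k --> \oo] --> xs ->
  forall i, (g i (blk i xs) < +oo)%E.
Proof.
move=> xc0 xxs i.
have [C Cbound] := block_bound f_diff g_prox_bounded xs c0.
rewrite ltNge leye_eq; apply/negP => /eqP gi.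
have [|W Wxs WC] := @g_lsc i (blk i xs) C; first by rewrite gi ltry.
have h1 : \forall k \near \oo, W (blk i (x k)) by exact: (cvg_blk (i:=i) xxs Wxs).
have h2 := xxs _ Cbound.
have [k [kW kC]] := filter_ex (filterI h1 h2).
by have := WC _ kW; rewrite ltNge kC.
Qed.

(** Lower semicontinuity handles the left side and continuity of the gradient the right side; the
    lower bound on the stepsizes keeps the quadratic coefficient bounded. *)
Lemma prox_direction_limit i (x d : nat -> V) (xs : V) (taumin : R) :
  0 < taumin -> x k @[k --> \oo] --> xs -> d k @[k --> \oo] --> (0 : V) ->
  (\forall k \near \oo, exists2 tau, taumin <= tau & prox_direction f g i tau (x k) (d k)) ->
  forall w, (g i (blk i xs) <= g i w + (dotv (blk i (grad f xs)) (w - blk i xs)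
      + (2 * taumin)^-1 * enorm (w - blk i xs) ^+ 2)%:E)%E.
Proof.
move=> tau0 xxs d0 pd w.
have [gN _] := g_proper i.
case gw : (g i w) (gN w) => [c||]// _; last by rewrite addye// leey.
rewrite -EFinD leNgt; apply/negP => hlt.
set r := c + _ in hlt.
(* A real [b] strictly between the two sides also covers an infinite [g i (blk i xs)]; by lower
   semicontinuity it stays below [g i] at the prox points, and the limit then yields [b <= r]. *)
have [b rb bg] : exists2 b : R, r < b & (b%:E < g i (blk i xs))%E.
  move: hlt; case: (g i (blk i xs)) => [s||]//; last first.
    by move=> _; exists (r + 1); rewrite ?ltrDl// ltry.
  by rewrite lte_fin => rs; exists ((r + s) / 2); rewrite ?lte_fin ?midf_lt.
have [W Wxs Wb] := g_lsc bg.
have gc : grad f (x k) @[k --> \oo] --> grad f xs.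
  exact: (cvg_comp _ _ xxs (grad_cont (x := xs))).
have uW : \forall k \near \oo, W (blk i (x k) + blk i (d k)).
  have : blk i (x k + d k) @[k --> \oo] --> blk i xs.
    by apply: cvg_blk; rewrite -[X in _ --> X]addr0; exact: cvgD.
  by under eq_fun do rewrite blkD; exact.
suff : b <= r by rewrite leNgt rb.
pose lhs k := b + dotv (blk i (grad f (x k))) (blk i (d k)).
pose rhs k := c + (dotv (blk i (grad f (x k))) (w - blk i (x k))
      + (2 * taumin)^-1 * enorm (w - blk i (x k)) ^+ 2).
have wc : w - blk i (x k) @[k --> \oo] --> w - blk i xs.
  by apply: cvgB; [exact: cvg_cst|exact: cvg_blk].
have cl : lhs k @[k --> \oo] --> b.
  rewrite -[X in _ --> X]addr0; apply: cvgD; first exact: cvg_cst.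
  rewrite -(dot0v (blk i (grad f xs))) dotvC; apply: cvg_dotv; first exact: cvg_blk.
  by rewrite -(mulmx0 _ ((Umx R n_ i)^T)); exact: (cvg_blk (i:=i) d0).
have cr : rhs k @[k --> \oo] --> r.
  apply: cvgD; first exact: cvg_cst.
  apply: cvgD; first by apply: cvg_dotv => //; exact: cvg_blk.
  by apply: cvgM; [exact: cvg_cst|exact: cvg_sqr_enorm].
apply: (ler_cvg_to cl cr).
apply: filterS2 uW pd => k /Wb bk [tau mtau /(prox_direction_le g_proper w)].
have tau_gt0 : 0 < tau by exact: lt_le_trans mtau.
move=> /(_ tau_gt0); rewrite gw /lhs /rhs.
move: bk; case: (g i (blk i (x k) + blk i (d k))) => [s||]//=.
rewrite -!EFinD lte_fin lee_fin => bs h.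
have t0 : (2 * tau)^-1 <= (2 * taumin)^-1.
  by rewrite lef_pV2 ?posrE ?mulr_gt0// ler_pM2l.
have := ler_wpM2r (sqr_ge0 (enorm (w - blk i (x k)))) t0.
have : 0 <= (2 * tau)^-1 * enorm (d k) ^+ 2.
  by rewrite mulr_ge0 ?sqr_ge0// invr_ge0 mulr_ge0// ltW.
by lra.
Qed.

(** Either the first trial is kept, with stepsize at least [taulo], or the previous trial was
    rejected: its stepsize exceeded [tau0], and one factor [beta] was applied since. *)
Lemma iteration_stepsize taulo tauhi a alpha beta i y d lam y' tau0 :
  0 < taulo -> 0 < tau0 -> 0 < beta -> beta < 1 ->
  arbpg_iteration f g taulo tauhi a alpha beta i y d lam y' ->
  (forall tau d', 0 < tau <= tau0 -> prox_direction f g i tau y d' ->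
     sufficient_decrease f g a y d') ->
  exists2 tau, Num.min taulo (beta * tau0) <= tau & prox_direction f g i tau y d.
Proof.
move=> taulo0 tau00 beta0 beta1 [taubar [T [dt [[lotau _] pd bt dE _]]]] small.
exists (beta ^+ T * taubar); last by rewrite dE; exact: pd.
case: T pd bt dE => [|T] pd bt dE; first by rewrite expr0 mul1r ge_min lotau.
rewrite ge_min; apply/orP; right; rewrite exprS -mulrA ler_pM2l//.
rewrite leNgt; apply/negP => lt0.
have [_] := bt T (ltnSn T); apply; apply: small (pd T (leqnSn T)).
by rewrite (ltW lt0) mulr_gt0 ?exprn_gt0// (lt_le_trans taulo0).
Qed.

(** [D i k] is the direction block [i] would produce from [x k], whichever block the run really
    drew; having all blocks at the same points is what allows the summation. *)
Lemma cluster_stationary taulo tauhi a alpha beta c0 (x : nat -> V)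
    (D : 'I_N -> nat -> V) xs :
  0 < taulo -> 0 < beta -> beta < 1 ->
  (forall k, (phi f g (x k) <= c0%:E)%E) ->
  (forall i k, exists lam y',
     arbpg_iteration f g taulo tauhi a alpha beta i (x k) (D i k) lam y') ->
  (forall i, D i k @[k --> \oo] --> (0 : V)) ->
  cluster (x @ \oo) xs -> stationary (phi f g) xs.
Proof.
move=> taulo0 beta0 beta1 xc0 xD D0 /cluster_subseq[u [um ux]].
have gdom := cluster_dom (fun k => xc0 (u k)) ux.
have gfin i : g i (blk i xs) \is a fin_num.
  by rewrite fin_numE -ltey gdom andbT; case: (g_proper i).
have xsdom : dom (gsum g) xs by rewrite /dom/=; apply: lte_sum_pinfty.
have [tau0 tau00 small] := small_step_sufficient_decrease f_diff grad_cont
  g_proper g_prox_bounded a c0 f_lip xsdom.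
pose taumin := Num.min taulo (beta * tau0).
have taumin0 : 0 < taumin by rewrite lt_min taulo0 mulr_gt0.
have key i := @prox_direction_limit i _ _ _ _ taumin0 ux
  (cvg_comp _ _ (cvg_minorized_subseq um) (D0 i)).
have {}key i w : (g i (blk i xs) <= g i w + (dotv (blk i (grad f xs)) (w - blk i xs)
      + (2 * taumin)^-1 * enorm (w - blk i xs) ^+ 2)%:E)%E.
  (* Along the subsequence the iterates enter the neighborhood where small stepsizes are accepted,
     so the stepsizes are at least [taumin]. *)
  apply: key; have [K _ KP] := ux _ small; exists K => // k /KP ks /=.
  have [lam [y' it]] := xD i (u k).
  apply: (iteration_stepsize taulo0 tau00 beta0 beta1 it) => tau d' tau_bd.
  by apply: ks => //; exact: xc0.
apply/(stationaryD _ (f_diff xs)); exists (- grad f xs); last by rewrite subrr.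
(* The coefficient is common to all blocks, so the blockwise squares add up to the full squared
   norm. *)
apply: (@subdiff_quadratic _ _ _ _ _ (2 * taumin)^-1).
  by apply/sum_fin_numP => i _ _; exact: gfin.
move=> y.
rewrite dotv_blk sqr_enorm_blk mulr_sumr -sumrB -sumEFin /gsum -big_split/=.
apply: lee_sum => i _; have := key i (blk i y).
rewrite blkB [blk i (- _)]mulmxN -/(blk i (grad f xs)) dotvNl.
case: (g i (blk i xs)) (gfin i) => [s _||]//.
case: (g i (blk i y)) => [t||]//=; last by move=> _; rewrite leey.
by rewrite -!EFinD !lee_fin; lra.
Qed.

End Stationarity.

(** * Events decided by the first draws *)

Section Past.
Context (Omega : Type) (N : nat) (ix : nat -> Omega -> 'I_N).
Implicit Types (A : set Omega) (k : nat) (w : Omega).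

Definition same_past k w w' := forall j, (j < k)%N -> ix j w = ix j w'.

(** A pointwise form of membership in the sigma-algebra of the first [k] draws: a union of classes
    of outcomes with equal past. *)
Definition saturated k A := forall w w', same_past k w w' -> A w -> A w'.

Lemma same_past_sym k w w' : same_past k w w' -> same_past k w' w.
Proof. by move=> ww' j jk; rewrite ww'. Qed.

Lemma same_past_trans k w1 w2 w3 :
  same_past k w1 w2 -> same_past k w2 w3 -> same_past k w1 w3.
Proof. by move=> h1 h2 j jk; rewrite h1// h2. Qed.

Lemma same_pastS k w w' :
  same_past k.+1 w w' <-> same_past k w w' /\ ix k w = ix k w'.
Proof.
split=> [ww'|[ww' kww'] j]; first by split=> [j jk|]; apply: ww' => //; exact: ltnW.
by rewrite ltnS leq_eqVlt => /orP[/eqP ->//|]; exact: ww'.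
Qed.

(** Saturated sets form a sigma-algebra containing the generators. *)
Lemma sigma_past_saturated k A : <<s past ix k>> A -> saturated k A.
Proof.
apply: (@smallest_sub _ _ _ (saturated k)); first split.
- by [].
- move=> B sB w w' ww' [_ nBw]; split=> // Bw'; apply: nBw.
  exact: sB (same_past_sym ww') Bw'.
- by move=> F sF w w' ww' [j _ Fj]; exists j => //; exact: sF ww' Fj.
by move=> _ [j [B [jk ->]]] w w' ww'; rewrite /= ww'.
Qed.

End Past.

(** * Independence of the draws and conditional Borel-Cantelli *)

Section Sampling.
Context (disp : measure_display) (Omega : measurableType disp) (R : realType).
Context (P : probability Omega R) (N : nat) (p : 'I_N -> R).
Context (ix : nat -> Omega -> 'I_N).
Hypothesis p_gt0 : forall i, 0 < p i.
Hypothesis ix_sampling : block_sampling P p ix.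
Implicit Types (A : set Omega) (k : nat) (w : Omega).

(** There are finitely many histories of length [k], so a saturated set is a finite union of finite
    intersections of generators. *)
Lemma saturated_sigma_past k A : saturated ix k A -> <<s past ix k>> A.
Proof.
move=> sA.
pose hist w := [ffun j : 'I_k => ix j w].
have -> : A = \bigcup_(h in [set h | exists2 w, A w & hist w = h])
    \bigcap_(j in [set: 'I_k]) (ix j @^-1` [set h j]).
  apply/seteqP; split=> [w Aw|w [_ [w' Aw' <-] hw]].
    by exists (hist w); [exists w|move=> j _ /=; rewrite ffunE].
  apply: sA Aw' => j jk; by have /= := hw (Ordinal jk) I; rewrite ffunE => ->.
apply: (@fin_bigcup_measurable _ (g_sigma_algebraType (past ix k))).
  exact: finite_finset.
move=> h _; apply: (@fin_bigcap_measurable _ (g_sigma_algebraType (past ix k))).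
  exact: finite_finset.
by move=> j _; apply: sub_gen_smallest; exists j, [set h j].
Qed.

Lemma measurable_ix k (B : set 'I_N) : measurable (ix k @^-1` B).
Proof.
have -> : ix k @^-1` B = \bigcup_(i in B) (ix k @^-1` [set i]).
  by apply/seteqP; split=> [w Bw|w [i Bi /= iw]]; [exists (ix k w)|rewrite /= iw].
apply: fin_bigcup_measurable; first exact: finite_finset.
by move=> i _; have [] := ix_sampling k i.
Qed.

Lemma saturated_measurable k A : saturated ix k A -> measurable A.
Proof.
move=> /saturated_sigma_past; apply: smallest_sub; first exact: sigma_algebra_measurable.
by move=> _ [j [B [_ ->]]]; exact: measurable_ix.
Qed.

Lemma saturated_indep k A i : saturated ix k A ->
  P (A `&` ix k @^-1` [set i]) = (P A * (p i)%:E)%E.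
Proof.
by move=> /saturated_sigma_past sA; have [_ <- h] := ix_sampling k i; exact: h.
Qed.

Lemma saturated_same_past k w : saturated ix k [set w' | same_past ix k w w'].
Proof. by move=> w1 w2 h1 /= h; exact: same_past_trans h h1. Qed.

(** By independence each further draw multiplies the probability by a positive [p]. *)
Lemma same_past_pos k w : (0 < P [set w' | same_past ix k w w'])%E.
Proof.
elim: k => [|k IH].
  by rewrite (_ : mkset _ = setT) ?probability_setT ?lte01//; apply/seteqP; split.
have -> : [set w' | same_past ix k.+1 w w'] =
    [set w' | same_past ix k w w'] `&` ix k @^-1` [set ix k w].
  by apply/seteqP; split=> w' /=; rewrite same_pastS => -[? ?].
rewrite saturated_indep; last exact: saturated_same_past.
by rewrite mule_gt0// lte_fin.
Qed.

(** Otherwise an event of positive probability would be empty. This makes virtual directions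
    available at every outcome, not merely almost everywhere. *)
Lemma resample k i w : exists w', same_past ix k w w' /\ ix k w' = i.
Proof.
apply: contrapT => nw.
have := saturated_indep i (saturated_same_past (k := k) (w := w)).
rewrite (_ : _ `&` _ = set0) ?measure0; last first.
  by apply/seteqP; split=> // w' [/= h1 h2]; apply: nw; exists w'.
have : (0 < P [set w' | same_past ix k w w'] * (p i)%:E)%E.
  by rewrite mule_gt0 ?same_past_pos// lte_fin.
by move=> + h; rewrite -h ltxx.
Qed.

(* A conditional Borel-Cantelli lemma: [A k], decided by the past, is followed
   by [B k] with conditional probability [p i]. *)
Lemma conditional_borel_cantelli i (A B : nat -> set Omega) (C : R) :
  (forall k, saturated ix k (A k)) -> (forall k, measurable (B k)) ->
  (forall k, A k `&` ix k @^-1` [set i] `<=` B k) ->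
  (forall n w, \sum_(0 <= k < n) \1_(B k) w <= C) ->
  {ae P, forall w, \forall k \near \oo, ~ A k w}.
Proof.
move=> sA mB AB BC.
have mA k : measurable (A k) by exact: saturated_measurable (sA k).
have sumB n : (\sum_(0 <= k < n) P (B k) <= C%:E)%E.
  (* The partial sum is the expected number of the first [n] events [B k] that occur, hence at most
     [C]. *)
  have -> : (\sum_(0 <= k < n) P (B k) =
      \int[P]_w (\sum_(0 <= k < n) (\1_(B k) w)%:E))%E.
    rewrite ge0_integral_sum//.
    - by apply: eq_bigr => k _; rewrite integral_indic// setIT.
    - move=> k; apply/measurable_EFinP; exact: measurable_indic.
  apply: (@le_trans _ _ (\int[P]_w (cst C%:E w))%E).
    apply: ge0_le_integral => //.
    - by move=> w _; apply: sume_ge0 => k _; rewrite lee_fin.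
    - apply: emeasurable_sum => k; apply/measurable_EFinP; exact: measurable_indic.
    - by move=> w _; rewrite sumEFin lee_fin.
  by rewrite integral_cst// [X in (_ * X)%E]probability_setT mule1.
(* Independence gives [p i * P (A k) <= P (B k)], so the first Borel-Cantelli lemma applies to
   [A]. *)
have sumA n : (\sum_(0 <= k < n) P (A k) <= ((p i)^-1 * C)%:E)%E.
  rewrite EFinM lee_pdivlMl// ge0_sume_distrr; last by move=> *; exact: measure_ge0.
  apply: le_trans (sumB n); apply: lee_sum => k _.
  rewrite muleC -(saturated_indep i (sA k)); apply: le_measure; rewrite ?inE//.
  by apply: measurableI => //; exact: measurable_ix.
exists (lim_sup_set A); split.
- apply: bigcapT_measurable => n; apply: bigcup_measurable => j _; exact: mA.
- apply: lim_sup_set_cvg0 => //; apply: le_lt_trans (ltry ((p i)^-1 * C)).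
  apply: lime_le; first by apply: is_cvg_nneseries => *; exact: measure_ge0.
  by apply: nearW => n; exact: sumA.
move=> w /= nA n _; apply: contrapT => nB; apply: nA.
by exists n => // j /= nj Aj; apply: nB; exists j.
Qed.

End Sampling.

(** * Decrease of the objective along a run *)

Section Descent.
Context (R : realType) (N : nat) (n_ : 'I_N -> nat).
Local Notation V := 'cV[R]_(\sum_(j < N) n_ j).
Context (f : V -> R) (g : forall i : 'I_N, 'cV[R]_(n_ i) -> \bar R).
Arguments g : clear implicits.

Lemma iteration_descent taulo tauhi a alpha beta i x d lam xn :
  arbpg_iteration f g taulo tauhi a alpha beta i x d lam xn ->
  xn = x + (1 + lam) *: d /\
  (phi f g xn <= phi f g x - ((a + alpha * lam ^+ 2) * enorm d ^+ 2)%:E)%E.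
Proof.
move=> [taubar [T [dt [_ pd _ dE [[d0 [-> ->]]|[_ sd lam0 sl ->]]]]]].
  (* The other blocks of a prox direction vanish anyway, so a zero [i]-th block means [d = 0]. *)
  have -> : d = 0.
    by have [ds _] := pd _ (leqnn T); rewrite -dE in ds; rewrite (Umx_blk ds) d0 mulmx0.
  by rewrite scaler0 addr0 enorm0 expr0n/= mulr0 sube0.
split; first by rewrite scalerDl scale1r addrA.
apply: le_trans sl _; rewrite mulrDl EFinD.
rewrite fin_num_oppeD// addeA leeD2r//.
Qed.

(* The steps vanish because [(1 + lam)^2 <= 2 (1 + lam^2)], so a squared step is
   at most a constant times the decrease of the objective. *)
Lemma run_descent a alpha c (x d : nat -> V) (lam : nat -> R) :
  0 < a -> 0 < alpha -> dom (phi f g) (x 0%N) ->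
  (forall y, (c%:E <= phi f g y)%E) ->
  (forall k, x k.+1 = x k + (1 + lam k) *: d k) ->
  (forall k, phi f g (x k.+1) <= phi f g (x k)
     - ((a + alpha * lam k ^+ 2) * enorm (d k) ^+ 2)%:E)%E ->
  [/\ forall k, (phi f g (x k) <= phi f g (x 0%N))%E,
      forall n, \sum_(0 <= k < n) a * enorm (d k) ^+ 2
                <= fine (phi f g (x 0%N)) - c
    & enorm (x k.+1 - x k) @[k --> \oo] --> (0 : R)].
Proof.
move=> a0 al0 x0dom cphi xS dec.
pose e k := (a + alpha * lam k ^+ 2) * enorm (d k) ^+ 2.
have e0 k : 0 <= e k.
  by rewrite mulr_ge0 ?sqr_ge0// addr_ge0 ?(ltW a0)// mulr_ge0 ?sqr_ge0// ltW.
have phiS k : (phi f g (x k.+1) <= phi f g (x k))%E.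
  by apply: le_trans (dec k) _; rewrite leeBlDr// leeDl// lee_fin e0.
have phi0 k : (phi f g (x k) <= phi f g (x 0%N))%E.
  by elim: k => // k IH; exact: le_trans (phiS k) IH.
have fin k : phi f g (x k) \is a fin_num.
  rewrite fin_numE -ltey -ltNye (le_lt_trans (phi0 k) x0dom) andbT.
  exact: lt_le_trans (ltNyr c) (cphi _).
pose v k := fine (phi f g (x k)).
have vE k : phi f g (x k) = (v k)%:E by rewrite fineK.
have vS k : v k.+1 <= v k - e k by have := dec k; rewrite !vE -EFinB lee_fin.
have cv k : c <= v k by have := cphi (x k); rewrite vE lee_fin.
have v_cvg : cvgn v.
  apply: nonincreasing_is_cvgn; last by exists c => _ [k _ <-].
  by apply/nonincreasing_seqP => k; have := vS k; have := e0 k; lra.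
split=> // [n|].
  rewrite -/(v 0%N); apply: le_trans (_ : v 0%N - v n <= _); last by rewrite lerD2l lerN2.
  elim: n => [|n IH]; first by rewrite big_nil subrr.
  rewrite big_nat_recr//=; have := vS n.
  have : a * enorm (d n) ^+ 2 <= e n.
    by rewrite ler_wpM2r ?sqr_ge0// lerDl mulr_ge0 ?sqr_ge0// ltW.
  by lra.
have vd : v k - v k.+1 @[k --> \oo] --> (0 : R).
  rewrite -(subrr (limn v)); apply: cvgB => //.
  by rewrite (cvg_shiftS v).
(* Chosen because [(a^-1 + alpha^-1) * (a + alpha * lam ^+ 2) >= 1 + lam ^+ 2]. *)
pose b := 2 * (a^-1 + alpha^-1).
have b0 : 0 < b by rewrite mulr_gt0// addr_gt0 ?invr_gt0.
have stepE k : enorm (x k.+1 - x k) ^+ 2 <= b * (v k - v k.+1).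
  rewrite xS addrAC subrr add0r sqr_enormZ.
  apply: le_trans (_ : b * e k <= _); last first.
    by rewrite ler_pM2l//; have := vS k; lra.
  rewrite /e [leRHS]mulrA ler_wpM2r ?sqr_ge0// /b.
  have h1 : (a^-1 + alpha^-1) * (a + alpha * lam k ^+ 2)
      = 1 + lam k ^+ 2 + a^-1 * alpha * lam k ^+ 2 + alpha^-1 * a.
    by field; rewrite !gt_eqF.
  rewrite -mulrA h1.
  have h2 : 0 <= a^-1 * alpha * lam k ^+ 2.
    by rewrite mulr_ge0 ?sqr_ge0// mulr_ge0 ?invr_ge0// ltW.
  have h3 : 0 <= alpha^-1 * a by rewrite mulr_ge0 ?invr_ge0// ltW.
  by have := sqr_ge0 (1 - lam k); nra.
apply/cvgr0Pnorm_lt => eps eps0.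
have d0 : 0 < eps ^+ 2 / b by rewrite divr_gt0// exprn_gt0.
move/cvgr0Pnorm_lt : vd => /(_ _ d0); apply: filterS => k.
have vge : 0 <= v k - v k.+1 by have := vS k; have := e0 k; lra.
rewrite ger0_norm//.
rewrite ltr_pdivlMr// mulrC => h.
rewrite ger0_norm ?enorm_ge0// -(@ltr_pXn2r _ 2)// ?nnegrE ?enorm_ge0 ?ltW//.
exact: le_lt_trans (stepE k) h.
Qed.

End Descent.

(** * Almost sure stationarity and convergence *)

Theorem theorem4p6 (R : realType) (N : nat) (N_gt0 : (0 < N)%N)
  (n_ : 'I_N -> nat)
  (f : 'cV[R]_(\sum_(j < N) n_ j) -> R)
  (g_ : forall i : 'I_N, 'cV[R]_(n_ i) -> \bar R)
  (A1 : assumption1 f g_)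
  (disp : measure_display) (Omega : measurableType disp)
  (P : probability Omega R)
  (x0 : 'cV[R]_(\sum_(j < N) n_ j)) (x0_dom : dom (phi f g_) x0)
  (taulo tauhi a alpha beta : R)
  (taulo_gt0 : 0 < taulo) (taulo_le_tauhi : taulo <= tauhi)
  (a_gt0 : 0 < a) (alpha_gt0 : 0 < alpha) (beta_gt0 : 0 < beta)
  (beta_lt1 : beta < 1)
  (p : 'I_N -> R) (p_gt0 : forall i, 0 < p i) (p_sum1 : \sum_(i < N) p i = 1)
  (ix : nat -> Omega -> 'I_N)
  (x d : nat -> Omega -> 'cV[R]_(\sum_(j < N) n_ j))
  (lambda : nat -> Omega -> R)
  (ix_sampling : block_sampling P p ix)
  (x_init : forall w, x 0%N w = x0)
  (x_run : forall k w, arbpg_iteration f g_ taulo tauhi a alpha beta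
     (ix k w) (x k w) (d k w) (lambda k w) (x k.+1 w))
  (x_adapted : forall k, borel_measurable (past ix k.+1)
     (fun w => (x k.+1 w, d k w, lambda k w))) :
  (forall xs, stationary (phi f g_) xs <->
     exists2 v, subdiff (gsum g_) xs v & grad f xs + v = 0) /\
  {ae P, forall w,
    (forall xs, cluster (x ^~ w @ \oo) xs -> stationary (phi f g_) xs) /\
    ((exists xs, isolated (cluster (x ^~ w @ \oo)) xs) ->
       exists2 xs, stationary (phi f g_) xs & x ^~ w @ \oo --> xs)}.
Proof.
have [[f_diff grad_cont] f_lip g_hyp inf_phi] := A1.
have g_proper i : Defs.proper (g_ i) by case: (g_hyp i).
have g_lsc i : lower_semicontinuous (g_ i) by case: (g_hyp i).
have g_pb i : prox_bounded (g_ i) by case: (g_hyp i).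
split; first by move=> xs; exact: stationaryD.
have [c cphi] : exists c : R, forall y, (c%:E <= phi f g_ y)%E.
  have inf_le y : (ereal_inf (range (phi f g_)) <= phi f g_ y)%E.
    by apply: ereal_inf_lbound; exists y.
  move: inf_phi inf_le; case: (ereal_inf _) => [c||]// _ h; first by exists c.
  by exists 0 => y; apply: le_trans (h y); rewrite leey.
have desc w : [/\ forall k, (phi f g_ (x k w) <= phi f g_ x0)%E,
    forall n, \sum_(0 <= k < n) a * enorm (d k w) ^+ 2 <= fine (phi f g_ x0) - c
    & enorm (x k.+1 w - x k w) @[k --> \oo] --> (0 : R)].
  rewrite -(x_init w).
  apply: (@run_descent _ _ _ _ _ a alpha c (x ^~ w) (d ^~ w) (lambda ^~ w)) => //.
  - by rewrite x_init.
  - by move=> k; case: (iteration_descent (x_run k w)).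
  - by move=> k; case: (iteration_descent (x_run k w)).
(* Singletons are closed, hence Borel, so the event that the triple takes a given value is
   saturated: the iterates are functions of the draws. *)
have x_det k w w' : same_past ix k.+1 w w' -> x k.+1 w = x k.+1 w' /\ d k w = d k w'.
  pose z := (x k.+1 w, d k w, lambda k w).
  have zcl : closed [set z].
    apply: accessible_closed_set1; apply: hausdorff_accessible.
    exact: (@norm_hausdorff R ('cV[R]_(\sum_(j < N) n_ j)
                               * 'cV[R]_(\sum_(j < N) n_ j) * R^o)%type).
  have zm : <<s @open ('cV[R]_(\sum_(j < N) n_ j)
                       * 'cV[R]_(\sum_(j < N) n_ j) * R)%type >> [set z].
    rewrite -[X in <<s _ >> X]setCK -setTD; apply: sigma_algebraCD.
    by apply: sub_gen_smallest; exact: closed_openC.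
  have := sigma_past_saturated (x_adapted k _ zm).
  by move=> /[apply] /(_ erefl) [-> -> _].
have x_past k w w' : same_past ix k w w' -> x k w = x k w'.
  by case: k => [|k ww']; rewrite ?x_init//; case: (x_det _ _ _ ww').
have B_sat k (e : R) : saturated ix k.+1 [set w | e <= enorm (d k w)].
  by move=> w w' ww' /=; case: (x_det _ _ _ ww') => _ ->.
(* The virtual direction of block [i] at time [k] has length at least [1 / (m + 1)]; quantifying
   over [w'] makes this depend on the past alone. *)
pose A i m k := [set w | exists w', [/\ same_past ix k w w', ix k w' = i
                                       & m.+1%:R^-1 <= enorm (d k w')]].
have A_fin i m : {ae P, forall w, \forall k \near \oo, ~ A i m k w}.
  pose e : R := m.+1%:R^-1.
  have e0 : 0 < e by rewrite invr_gt0.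
  have ae0 : 0 < a * e ^+ 2 by rewrite mulr_gt0// exprn_gt0.
  apply: (@conditional_borel_cantelli _ _ _ P _ p ix p_gt0 ix_sampling i _
    (fun k => [set w | e <= enorm (d k w)])
    (* Each real direction of length at least [e] costs [a * e ^+ 2] of the total decrease, so this
       bounds how many there are. *)
    ((a * e ^+ 2)^-1 * (fine (phi f g_ x0) - c))).
  - move=> k w1 w2 w12 [w' [w1w' ikw' ew']]; exists w'; split=> //.
    exact: same_past_trans (same_past_sym w12) w1w'.
  - by move=> k; exact: (saturated_measurable ix_sampling (B_sat k e)).
  - move=> k w [[w' [ww' ikw' ew']] /= ikw].
    by have [|_ ->//] := x_det k w w'; apply/same_pastS; rewrite ikw ikw'.
  - move=> n w; rewrite ler_pdivlMl// mulr_sumr.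
    have [_ /(_ n) sn _] := desc w; apply: le_trans sn; apply: ler_sum => k _.
    rewrite indicE; case: (boolP (w \in _)) => [/set_mem/= ew|_]; last first.
      by rewrite mulr0 mulr_ge0 ?sqr_ge0// ltW.
    by rewrite mulr1 ler_pM2l// ler_pXn2r ?nnegrE ?enorm_ge0// ltW.
have : {ae P, forall w, forall i m, \forall k \near \oo, ~ A i m k w}.
  apply: filter_forall => i; apply: ae_foralln => m; exact: A_fin.
apply: filterS => w Aw.
have stat xs : cluster (x ^~ w @ \oo) xs -> stationary (phi f g_) xs.
  (* [D (i, k)] is an outcome with the past of [w] that draws [i] at time [k]; it shares the iterate
     [x k], and its direction is the virtual one. *)
  have /choice[D DP] : forall ik : 'I_N * nat, exists w',
      same_past ix ik.2 w w' /\ ix ik.2 w' = ik.1.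
    by move=> [i k]; exact: (resample p_gt0 ix_sampling).
  have [phi_le _ _] := desc w.
  have phi0E : phi f g_ x0 = (fine (phi f g_ x0))%:E.
    rewrite fineK// fin_numE -ltey -ltNye x0_dom andbT.
    exact: lt_le_trans (ltNyr c) (cphi _).
  apply: (cluster_stationary f_diff grad_cont g_proper g_lsc g_pb f_lip
    (c0 := fine (phi f g_ x0)) (D := fun i k => d k (D (i, k))) taulo_gt0 beta_gt0 beta_lt1).
  - by move=> k; rewrite -phi0E.
  - move=> i k; have [/x_past /= xk /= iD] := DP (i, k).
    exists (lambda k (D (i, k))), (x k.+1 (D (i, k))).
    by have := x_run k (D (i, k)); rewrite -xk iD; exact.
  - move=> i; apply/cvg_enormP => e e0; have [m _ mP] := near_infty_natSinv_lt (PosNum e0).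
    apply: filterS (Aw i m) => k nA; rewrite subr0.
    have := mP m (leqnn m); apply: le_lt_trans; rewrite leNgt; apply/negP => dk.
    apply: nA; have [ww' iD] := DP (i, k).
    by exists (D (i, k)); split=> //; exact: ltW.
split=> // -[xs xs_iso]; exists xs; first by apply: stat; exact: isolatedS xs_iso.
by apply: isolated_cluster_cvg xs_iso _; case: (desc w).
Qed.
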